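(* Let $m$ and $n$ be natural numbers. Then the lattice $\mathsf{B}(m,n)$ embeds (as a lattice) into some Tamari lattice $\mathsf{A}(\ell)$ ($\ell$ a positive integer) if and only if either $m\le1$ or $n\le1$.
   Context: For natural numbers $m,n$ (possibly zero), $\mathsf{B}(m,n)$ is the lattice obtained by doubling the join of $m$ atoms in the Boolean lattice with $m+n$ atoms: take the finite Boolean lattice $B$ with atoms $\boldsymbol a_1,\dots,\boldsymbol a_m,\boldsymbol b_1,\dots,\boldsymbol b_n$, put $\boldsymbol a=\boldsymbol a_1\vee\dots\vee\boldsymbol a_m$, and let $\mathsf{B}(m,n)=B\cup\{\boldsymbol p\}$ with a new element $\boldsymbol p$, where the order extends that of $B$ and, for $x\in B$, $x<\boldsymbol p$ iff $x\le\boldsymbol a$, and $\boldsymbol p<x$ iff $\boldsymbol a<x$. Tamari lattices: with $[\ell]=\{1,\dots,\ell\}$ and $\mathcal{I}_\ell=\{(i,j)\in[\ell]\times[\ell] : i<j\}$, $\mathsf{A}(\ell)$ is the set of all transitive subsets $\boldsymbol{x}\subseteq\mathcal{I}_\ell$ such that $1\le i<j<k\le\ell$ and $(i,k)\in\boldsymbol{x}$ imply $(i,j)\in\boldsymbol{x}$, ordered by inclusion; it is a lattice. A lattice embedding is an injective map preserving binary meets and joins (it need not preserve the bounds). *)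

(* Defs.v *)
From HB Require Import structures.
From mathcomp Require Import all_boot all_order.

Set Implicit Arguments.
Unset Strict Implicit.
Unset Printing Implicit Defensive.

Import Order.TTheory.

(* Bounds, if any, need not be preserved. *)
Definition lattice_embedding (d d' : Order.disp_t) (L : latticeType d)
    (K : latticeType d') (f : L -> K) : Prop :=
  [/\ injective f,
      forall x y, f (Order.meet x y) = Order.meet (f x) (f y)
    & forall x y, f (Order.join x y) = Order.join (f x) (f y)].

Definition lattice_embeds (d d' : Order.disp_t) (L : latticeType d)
    (K : latticeType d') : Prop :=
  exists f : L -> K, lattice_embedding f.

(* The Boolean lattice with atoms a_1, ..., a_m, b_1, ..., b_n is the powerset
   of 'I_m + 'I_n; [Some X] is the element X of it, [None] is the new element
   p. *)
Definition dbool (m n : nat) : Type := option {set 'I_m + 'I_n}.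

HB.instance Definition _ (m n : nat) := Finite.on (dbool m n).

Fact dbool_display : Order.disp_t. Proof. exact: Order.Disp tt tt. Qed.

Section DBool.
Variables m n : nat.
Implicit Types (x y z : dbool m n) (X Y Z : {set 'I_m + 'I_n}).

Definition dbool_a : {set 'I_m + 'I_n} := [set inl i | i : 'I_m].

Definition dbool_le x y : bool :=
  match x, y with
  | Some X, Some Y => X \subset Y
  | Some X, None => X \subset dbool_a
  | None, Some Y => dbool_a \proper Y
  | None, None => true
  end.

Fact dbool_le_refl : reflexive dbool_le.
Proof. by case=> /=. Qed.

Fact dbool_le_anti : antisymmetric dbool_le.
Proof.
case=> [X|] [Y|] //= /andP[].
- by move=> XY YX; congr Some; apply/eqP; rewrite eqEsubset XY.
- by move=> Xa /proper_sub_trans/(_ Xa); rewrite properxx.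
- by move=> aY Ya; have := proper_sub_trans aY Ya; rewrite properxx.
Qed.

Fact dbool_le_trans : transitive dbool_le.
Proof.
case=> [Y|] [X|] [Z|] //=.
- exact: subset_trans.
- exact: subset_trans.
- exact: proper_sub_trans.
- by move=> Xa /proper_sub; apply: subset_trans.
Qed.

HB.instance Definition _ := Order.Le_isPOrder.Build dbool_display (dbool m n)
  dbool_le_refl dbool_le_anti dbool_le_trans.

Definition dbool_meet x y : dbool m n :=
  match x, y with
  | Some X, Some Y =>
      if [&& dbool_a \proper X, dbool_a \proper Y & X :&: Y == dbool_a]
      then None else Some (X :&: Y)
  | Some X, None | None, Some X =>
      if dbool_a \proper X then None else Some (X :&: dbool_a)
  | None, None => None
  end.

Definition dbool_join x y : dbool m n :=
  match x, y with
  | Some X, Some Y => Some (X :|: Y)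
  | Some X, None | None, Some X =>
      if X \subset dbool_a then None else Some (X :|: dbool_a)
  | None, None => None
  end.

Fact dbool_meetP x y z :
  dbool_le x (dbool_meet y z) = dbool_le x y && dbool_le x z.
Proof.
have Ha (X Y : {set 'I_m + 'I_n}) : dbool_a \proper Y ->
    (X \subset dbool_a) = (X \subset Y) && (X \subset dbool_a).
  move=> /proper_sub aY; case: (boolP (X \subset _)) => [Xa|]; last by rewrite andbF.
  by rewrite (subset_trans Xa aY).
case: y z => [Y|] [Z|] /=; last by rewrite andbb.
- case: ifPn => [/and3P[aY aZ /eqP YZ]|nYZ]; case: x => [X|] /=.
  + by rewrite -YZ subsetI.
  + by rewrite aY aZ.
  + by rewrite subsetI.
  + rewrite properE subsetI; case: (boolP (dbool_a \proper Y)) nYZ => [aY|naY].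
      case: (boolP (dbool_a \proper Z)) => [aZ /= ne|naZ _].
        rewrite (proper_sub aY) (proper_sub aZ) /=.
        apply: contraNN ne => YZa; rewrite eqEsubset YZa subsetI.
        by rewrite (proper_sub aY) (proper_sub aZ).
      apply/negbTE/negP => /andP[/andP[_ aZ]]; case/negP.
      by move: naZ; rewrite properE aZ negbK; apply: subset_trans; apply: subsetIr.
    move=> _; apply/negbTE/negP => /andP[/andP[aY _]]; case/negP.
    by move: naY; rewrite properE aY negbK; apply: subset_trans; apply: subsetIl.
- case: ifPn => aY; case: x => [X|] /=; rewrite ?aY ?subsetI //; first exact: Ha.
  by rewrite properE subsetIr andbF (negbTE aY).
- case: ifPn => aZ; case: x => [X|] /=; rewrite ?aZ ?subsetI //.
  + by rewrite andbC; apply: Ha.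
  + by rewrite andbC.
  + by rewrite properE subsetIr andbF (negbTE aZ).
Qed.

Fact dbool_joinP x y z :
  dbool_le (dbool_join x y) z = dbool_le x z && dbool_le y z.
Proof.
have Ha (X Y : {set 'I_m + 'I_n}) : X \subset dbool_a ->
    (dbool_a \proper Y) = (X \subset Y) && (dbool_a \proper Y).
  move=> Xa; case: (boolP (dbool_a \proper Y)) => [aY|]; last by rewrite andbF.
  by rewrite (subset_trans Xa (proper_sub aY)).
have Hn (X Y : {set 'I_m + 'I_n}) : ~~ (X \subset dbool_a) ->
    (X :|: dbool_a \subset Y) = (X \subset Y) && (dbool_a \proper Y).
  move=> nXa; rewrite subUset properE.
  case: (boolP (X \subset Y)) => //= XY; case: (boolP (_ \subset Y)) => //= aY.
  by apply/esym; apply: contra nXa; apply: subset_trans.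
case: x y => [X|] [Y|] /=; last by rewrite andbb.
- by case: z => [Z|] /=; rewrite subUset.
- case: ifPn => Xa; case: z => [Z|] /=; rewrite ?Xa //.
  + exact: Ha.
  + exact: Hn.
  + by rewrite subUset (negbTE Xa).
- case: ifPn => Ya; case: z => [Z|] /=; rewrite ?Ya //.
  + by rewrite andbC; apply: Ha.
  + by rewrite andbC; apply: Hn.
  + by rewrite subUset (negbTE Ya).
Qed.

HB.instance Definition _ := Order.POrder_MeetJoin_isLattice.Build
  dbool_display (dbool m n) dbool_meetP dbool_joinP.

End DBool.

(* The index set {1, ..., l} is represented by 'I_l = {0, ..., l - 1}. *)
Definition is_tamari (l : nat) (x : {set 'I_l * 'I_l}) : bool :=
  [&& [forall i, forall j, ((i, j) \in x) ==> (i < j)],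
      [forall i, forall j, forall k,
         ((i, j) \in x) ==> ((j, k) \in x) ==> ((i, k) \in x)]
    & [forall i : 'I_l, forall j : 'I_l, forall k : 'I_l,
         (i < j < k) ==> ((i, k) \in x) ==> ((i, j) \in x)]].

Record tamari (l : nat) := Tamari {
  tamari_val :> {set 'I_l * 'I_l};
  tamari_valP : is_tamari tamari_val }.

HB.instance Definition _ (l : nat) := [isSub for @tamari_val l].
HB.instance Definition _ (l : nat) := [Finite of tamari l by <:].

Fact tamari_display : Order.disp_t. Proof. exact: Order.Disp tt tt. Qed.

Section TamariLattice.
Variable l : nat.
Implicit Types x y z : tamari l.

Definition tamari_le x y : bool := tamari_val x \subset tamari_val y.

Fact tamari_le_refl : reflexive tamari_le.
Proof. by move=> x; apply: subxx. Qed.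

Fact tamari_le_anti : antisymmetric tamari_le.
Proof. by move=> x y; rewrite /tamari_le -eqEsubset => /eqP/val_inj. Qed.

Fact tamari_le_trans : transitive tamari_le.
Proof. by move=> y x z; apply: subset_trans. Qed.

HB.instance Definition _ := Order.Le_isPOrder.Build tamari_display (tamari l)
  tamari_le_refl tamari_le_anti tamari_le_trans.

Fact is_tamariP (x : {set 'I_l * 'I_l}) :
  reflect [/\ forall i j : 'I_l, (i, j) \in x -> i < j,
              forall i j k, (i, j) \in x -> (j, k) \in x -> (i, k) \in x
            & forall i j k : 'I_l, i < j < k -> (i, k) \in x -> (i, j) \in x]
          (is_tamari x).
Proof.
apply: (iffP and3P) => -[h1 h2 h3]; split.
- by move=> i j; apply/implyP; move/forallP/(_ i)/forallP: h1; apply.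
- move=> i j k xij; apply/implyP; move: xij; apply/implyP.
  by move/forallP/(_ i)/forallP/(_ j)/forallP: h2; apply.
- move=> i j k ijk; apply/implyP; move: ijk; apply/implyP.
  by move/forallP/(_ i)/forallP/(_ j)/forallP: h3; apply.
- by apply/forallP=> i; apply/forallP=> j; apply/implyP; apply: h1.
- apply/forallP=> i; apply/forallP=> j; apply/forallP=> k.
  by apply/implyP=> xij; apply/implyP; apply: h2.
- apply/forallP=> i; apply/forallP=> j; apply/forallP=> k.
  by apply/implyP=> ijk; apply/implyP; apply: h3.
Qed.

Fact is_tamari_full : is_tamari [set ij : 'I_l * 'I_l | ij.1 < ij.2].
Proof.
apply/is_tamariP; split=> [i j|i j k|i j k /andP[]]; rewrite ?inE //=.
exact: ltn_trans.
Qed.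

Definition tamari_top : tamari l := Tamari is_tamari_full.

Fact is_tamari_meet x y : is_tamari (tamari_val x :&: tamari_val y).
Proof.
have [/is_tamariP[x1 x2 x3] /is_tamariP[y1 y2 y3]] := (valP x, valP y).
apply/is_tamariP; split=> [i j|i j k|i j k ijk]; rewrite !inE.
- by case/andP=> /x1.
- by case/andP=> xij yij /andP[xjk yjk]; rewrite (x2 _ j) // (y2 _ j).
- by case/andP=> xik yik; rewrite (x3 _ _ k) // (y3 _ _ k).
Qed.

Definition tamari_meet x y : tamari l := Tamari (is_tamari_meet x y).

Definition tamari_join x y : tamari l :=
  \big[tamari_meet/tamari_top]_(z | tamari_le x z && tamari_le y z) z.

Fact tamari_meetP x y z :
  tamari_le x (tamari_meet y z) = tamari_le x y && tamari_le x z.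
Proof. exact: subsetI. Qed.

Fact tamari_le_top x : tamari_le x tamari_top.
Proof.
by apply/subsetP=> -[i j]; have /is_tamariP[x1 _ _] := valP x; rewrite inE => /x1.
Qed.

Fact tamari_joinP x y z :
  tamari_le (tamari_join x y) z = tamari_le x z && tamari_le y z.
Proof.
have lb w : tamari_le w x || tamari_le w y -> tamari_le w (tamari_join x y).
  move=> wxy; rewrite /tamari_join; elim/big_rec: _ => [|u v /andP[xu yu] wv].
    exact: tamari_le_top.
  rewrite tamari_meetP wv andbT.
  by case/orP: wxy => /tamari_le_trans; apply.
apply/idP/andP => [jz|[xz yz]].
  by split; apply: tamari_le_trans jz; apply: lb; rewrite tamari_le_refl ?orbT.
rewrite /tamari_join; have: z \in index_enum (tamari l) by apply: mem_index_enum.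
elim: (index_enum _) => //= u s IHs; rewrite inE big_cons => zs.
case: (z =P u) zs => [<- _|_ /= /IHs le_z]; first by rewrite xz yz; apply: subsetIl.
case: ifP => // _; apply: tamari_le_trans le_z; exact: subsetIr.
Qed.

HB.instance Definition _ := Order.POrder_MeetJoin_isLattice.Build
  tamari_display (tamari l) tamari_meetP tamari_joinP.

End TamariLattice.

(* Main.v *)
Require Import Defs.
From mathcomp Require Import all_boot all_order.
From mathcomp Require Import zify.

(** In a Tamari lattice, meet is intersection and join is the transitive closure
    of the union.

    If [m, n >= 2], put [a = a1 \/ a2], with [a1] one atom below [a] and [a2] the
    join of the others. In the image of an embedding, pick [(i, k)] in
    [(a \/ b1) /\ (a \/ b2)] but not in [a], with [k] least. The last steps of
    chains from [i] to [k] are some [(u, k)] in [b1] and [(u', k)] in [b2], and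
    [u <> u'], say [u < u']. A chain from [i] to [u'] in [a] has a step
    [(c, c')], in [ae] say, with [c <= u < c']. Then [(c, k)] is in [ae \/ b1],
    so [(c, u')] is in [(ae \/ b1) /\ a = ae], so [(c, k)] is in
    [(ae \/ b1) /\ (ae \/ b2) = ae], and [(i, k)] is in [a], a contradiction.
    Thus [(a \/ b1) /\ (a \/ b2) = a], although [p] is below the left-hand side.

    If [m <= 1], send [a], [p], [b_j] to the join-irreducible elements generated
    by [(0, n+1)], [(0, n+2)], [(j, n+2)], for [1 <= j <= n]. If [n <= 1 < m],
    send the [i]th atom to [{(i, i+1)}], with [b] coming last, and [p] to
    [a] together with [(0, m+1)]. *)

Import Order.TTheory.

Set Implicit Arguments.
Unset Strict Implicit.
Unset Printing Implicit Defensive.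

(** * Chains and joins in a Tamari lattice *)

Section TamariJoin.
Variable l : nat.
Implicit Types (x y z : tamari l) (i j k c : 'I_l).

Lemma tamari_lt x i j : (i, j) \in tamari_val x -> i < j.
Proof. by case/is_tamariP: (tamari_valP x) => h _ _; apply: h. Qed.

Lemma tamari_trans x i j k : (i, j) \in tamari_val x ->
  (j, k) \in tamari_val x -> (i, k) \in tamari_val x.
Proof. by case/is_tamariP: (tamari_valP x) => _ h _; apply: h. Qed.

Lemma tamari_prefix x i j k : i < j -> j <= k ->
  (i, k) \in tamari_val x -> (i, j) \in tamari_val x.
Proof.
move=> ij; rewrite leq_eqVlt => /orP[/eqP/val_inj-> //|jk].
by case/is_tamariP: (tamari_valP x) => _ _; apply; rewrite ij.
Qed.

Definition tamari_refl x i j := (i == j) || ((i, j) \in tamari_val x).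

Lemma tamari_reflP x i j : i <= j -> (i < j -> (i, j) \in tamari_val x) ->
  tamari_refl x i j.
Proof.
rewrite /tamari_refl leq_eqVlt => /orP[/eqP/val_inj->|ij /(_ ij)->].
  by rewrite eqxx.
by rewrite orbT.
Qed.

Lemma tamari_refl_leq x i j : tamari_refl x i j -> i <= j.
Proof. by case/orP=> [/eqP-> //|/tamari_lt/ltnW]. Qed.

Lemma tamari_refl_transl x i j k : tamari_refl x i j ->
  (j, k) \in tamari_val x -> (i, k) \in tamari_val x.
Proof. by case/orP=> [/eqP-> //|]; apply: tamari_trans. Qed.

Lemma tamari_refl_transr x i j k : (i, j) \in tamari_val x ->
  tamari_refl x j k -> (i, k) \in tamari_val x.
Proof. by move=> ij /orP[/eqP<- //|]; apply: tamari_trans. Qed.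

Lemma tamari_steps x i j : i < j ->
  (forall s t : 'I_l, i <= s -> t = s.+1 :> nat -> t <= j -> (s, t) \in tamari_val x) ->
  (i, j) \in tamari_val x.
Proof.
case: j => j; elim: j => // j IHj jl /= ij step.
have jl' : j < l by apply: ltnW.
have last_step : (Ordinal jl', Ordinal jl) \in tamari_val x by exact: step.
apply: tamari_refl_transl last_step; apply: tamari_reflP => //= ij'.
by apply: IHj => // s t si ts tj; apply: step => //; apply: ltnW.
Qed.

Lemma tamari_leP x y :
  reflect (forall i j, (i, j) \in tamari_val x -> (i, j) \in tamari_val y) (x <= y)%O.
Proof.
by apply: (iffP subsetP) => [h i j|h [i j]]; apply: h.
Qed.

Lemma in_tamari_meet x y i j : ((i, j) \in tamari_val (x `&` y)%O) =
  ((i, j) \in tamari_val x) && ((i, j) \in tamari_val y).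
Proof. exact: in_setI. Qed.

Definition tamari_union x y : rel 'I_l :=
  fun i j => ((i, j) \in tamari_val x) || ((i, j) \in tamari_val y).

Lemma tamari_union_lt x y i j : tamari_union x y i j -> i < j.
Proof. by case/orP=> /tamari_lt. Qed.

Lemma tamari_union_connect_leq x y i j : connect (tamari_union x y) i j -> i <= j.
Proof.
case/connectP=> p; elim: p i => [|c p IHp] i /=; first by move=> _ ->.
case/andP=> /tamari_union_lt ic cp jE; exact: leq_trans (ltnW ic) (IHp _ cp jE).
Qed.

(** For the prefix condition, follow a chain from [i] to [k] up to its first step that reaches [j]
    or beyond. That step, cut at [j], lies in the same one of [x] and [y]. *)
Lemma is_tamari_closure x y : is_tamari
  [set ij : 'I_l * 'I_l | (ij.1 < ij.2) && connect (tamari_union x y) ij.1 ij.2].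
Proof.
apply/is_tamariP; split=> [i j|i j k|i j k /andP[ij jk]]; rewrite !inE /=.
- by case/andP.
- case/andP=> ij cij /andP[jk cjk].
  by rewrite (ltn_trans ij jk) (connect_trans cij cjk).
- case/andP=> _ /connectP[p]; rewrite ij /=.
  elim: p i ij => [|c p IHp] i ij /=; first by move=> _ kE; rewrite kE in jk; lia.
  case/andP=> ic cp kE; have [cj|jc] := ltnP c j.
    exact: connect_trans (connect1 ic) (IHp _ cj cp kE).
  by apply: connect1; case/orP: ic => /(tamari_prefix ij jc); rewrite /tamari_union => ->;
     rewrite ?orbT.
Qed.

Lemma tamari_join_mem x y i j : tamari_union x y i j -> (i, j) \in tamari_val (x `|` y)%O.
Proof. by case/orP; apply/tamari_leP; rewrite ?leUl ?leUr. Qed.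

(** The join lies in the transitive closure of the union, so a chain of union steps leads from [i]
    to [k], and one of these steps passes over [u]. *)
Lemma tamari_join_step x y i k (u : nat) : (i, k) \in tamari_val (x `|` y)%O ->
  i <= u < k ->
  exists c c', [/\ c <= u < c', tamari_refl (x `|` y)%O i c,
                tamari_union x y c c' & tamari_refl (x `|` y)%O c' k].
Proof.
set J := (x `|` y)%O => ik iuk.
have : (J <= Tamari (is_tamari_closure x y))%O.
  rewrite leUx; apply/andP; split; apply/tamari_leP=> c c' cc'; rewrite inE /=;
    by rewrite (tamari_lt cc') connect1 // /tamari_union cc' ?orbT.
move/tamari_leP/(_ _ _ ik); rewrite inE /= => /andP[_ /connectP[p]].
elim: p i iuk {ik} => [|c p IHp] i iuk /=; first by move=> _ kE; rewrite kE in iuk; lia.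
case/andP=> ic cp kE; case/andP: iuk => iu uk.
have [uc|cu] := ltnP u c.
  exists i, c; rewrite iu uc /tamari_refl eqxx; split=> //; apply/orP.
  have : c <= k by apply: (@tamari_union_connect_leq x y); apply/connectP; exists p.
  rewrite leq_eqVlt => /orP[/eqP/val_inj->|ck]; [by left | right].
  elim: p c {ic IHp uc} cp kE ck => [|d p IHp] c /=; first by move=> _ ->; rewrite ltnn.
  case/andP=> cd dp kE _; apply: (tamari_refl_transr (tamari_join_mem cd)).
  apply: tamari_reflP; last exact: IHp.
  by apply: (@tamari_union_connect_leq x y); apply/connectP; exists p.
have cuk : c <= u < k by rewrite cu.
have [d [d' [dud' cd dd' d'k]]] := IHp _ cuk cp kE.
exists d, d'; split=> //; apply/orP; right; exact: tamari_refl_transr (tamari_join_mem ic) cd.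
Qed.

(** Here [b] and [b'] stand for [b1] and [b2] in either order, which makes [u < u'] no restriction.
    The element [e] is the one of [a1], [a2] that contains the step passing over [u]. *)
Lemma tamari_join_shift (a1 a2 b b' : tamari l) (i k u u' : 'I_l) :
  (forall e, e \in [:: a1; a2] ->
     ((e `|` b) `&` (a1 `|` a2) <= e)%O && ((e `|` b) `&` (e `|` b') <= e)%O) ->
  i <= u -> u < u' -> (i, u') \in tamari_val (a1 `|` a2)%O ->
  (u, k) \in tamari_val b -> (u', k) \in tamari_val b' ->
  (i, k) \in tamari_val (a1 `|` a2)%O.
Proof.
move=> distr iu uu' iu' uk u'k.
have iuu' : i <= u < u' by rewrite iu.
have [c [c' [/andP[cu uc'] ic cc' c'u']]] := tamari_join_step iu' iuu'.
have [e [e_in eJ ecc']] : exists e, [/\ e \in [:: a1; a2], (e <= a1 `|` a2)%O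
    & (c, c') \in tamari_val e].
  case/orP: cc' => cc'; [exists a1 | exists a2]; by rewrite !inE eqxx ?orbT ?leUl ?leUr.
have /andP[/tamari_leP ea /tamari_leP eb] := distr _ e_in.
have le_e y : (e <= e `|` y)%O by apply: leUl.
have le_y y : (y <= e `|` y)%O by apply: leUr.
have cku : (c, k) \in tamari_val (e `|` b)%O.
  apply: (@tamari_refl_transl _ _ u); last by move/tamari_leP: (le_y b); apply.
  apply: tamari_reflP => // cu'; apply: (tamari_prefix cu' (ltnW uc')).
  by move/tamari_leP: (le_e b); apply.
have u'ltk := tamari_lt u'k.
(* The pair [(c, u')] is a prefix of [(c, k)], hence in the join of [e] and [b]; it is below [a1],
   [a2] joined by way of [c']. *)
have cu' : (c, u') \in tamari_val e.
  apply: ea; rewrite in_tamari_meet (tamari_prefix _ (ltnW u'ltk) cku) /=; last by lia.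
  by apply: (tamari_refl_transr _ c'u'); move/tamari_leP: eJ; apply.
have ck : (c, k) \in tamari_val e.
  apply: eb; rewrite in_tamari_meet cku /=.
  apply: (@tamari_trans _ _ u'); first by move/tamari_leP: (le_e b'); apply.
  by move/tamari_leP: (le_y b'); apply.
by apply: (tamari_refl_transl ic); move/tamari_leP: eJ; apply.
Qed.

(** By strong induction on the right end [k], with [i] fixed, every shorter pair [(i, u)] of [w] is
    already in [a]; only the last steps into [k] matter. *)
Lemma tamari_join_distr (a1 a2 b1 b2 : tamari l) :
  (b1 `&` b2 <= a1 `|` a2)%O ->
  (forall e, e \in [:: a1; a2] ->
     [/\ ((e `|` b1) `&` (a1 `|` a2) <= e)%O, ((e `|` b2) `&` (a1 `|` a2) <= e)%O
       & ((e `|` b1) `&` (e `|` b2) <= e)%O]) ->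
  (((a1 `|` a2) `|` b1) `&` ((a1 `|` a2) `|` b2) <= a1 `|` a2)%O.
Proof.
set a := (a1 `|` a2)%O => b12 distr; set w := (_ `&` _)%O.
apply/tamari_leP => i k; have [N] := ubnP (val k).
elim: N k => // N IHN k kN ikw.
have ik := tamari_lt ikw.
have [//|/negP ika] := orP (orbN ((i, k) \in tamari_val a)).
have last_step b : (i, k) \in tamari_val (a `|` b)%O ->
    exists u : 'I_l, [/\ i <= u, i < u -> (i, u) \in tamari_val a & (u, k) \in tamari_val b].
  (* Asking for the step over [k - 1] yields the last one: its right end exceeds [k - 1] and is at
     most [k]. *)
  move=> ikb; have iuk : i <= k.-1 < k by lia.
  have [u [v [/andP[uk kv] iu uv vk]]] := tamari_join_step ikb iuk.
  have vkE : v = k by apply: val_inj; have /= := tamari_refl_leq vk; lia.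
  subst v; have ule := tamari_refl_leq iu; have ult := tamari_union_lt uv.
  have iua : i < u -> (i, u) \in tamari_val a.
    move=> iu'; apply: IHN; first exact: leq_trans ult kN.
    by apply: tamari_prefix ikw; rewrite ?(ltnW ult).
  (* A last step in [a] would put [(i, k)] in [a], so it lies in [b]. *)
  exists u; split=> //; case/orP: uv => // uka.
  by case: ika; apply: (tamari_refl_transl _ uka); apply: tamari_reflP.
move: (ikw); rewrite in_tamari_meet => /andP[/last_step[u [iu iua uk]]].
case/last_step=> v [iv iva vk].
have [uv|vu|uv] := ltngtP u v.
- apply: (tamari_join_shift _ iu uv _ uk vk) => [e /distr[-> _ ->] //|].
  by apply: iva; lia.
- apply: (tamari_join_shift _ iv vu _ vk uk) => [e /distr[_ -> h] |].
    by rewrite meetC.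
  by apply: iua; lia.
- have uvE : u = v by apply: val_inj.
  subst v; apply: (@tamari_refl_transl _ _ u); first exact: tamari_reflP.
  by move/tamari_leP: b12; apply; rewrite in_tamari_meet uk.
Qed.

End TamariJoin.

(** Preserving meets makes [f] monotone, so one inequality for joins is automatic and only the other
    is assumed; reflecting the order gives injectivity. *)
Lemma tamari_embedding_of_meet (d : Order.disp_t) (L : latticeType d) (l : nat)
    (f : L -> tamari l) :
  (forall x y i j, ((i, j) \in tamari_val (f (x `&` y)%O)) =
     ((i, j) \in tamari_val (f x)) && ((i, j) \in tamari_val (f y))) ->
  (forall x y i j, (i, j) \in tamari_val (f (x `|` y)%O) ->
     (i, j) \in tamari_val (f x `|` f y)%O) ->
  (forall x y, (f x <= f y)%O -> (x <= y)%O) ->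
  lattice_embedding f.
Proof.
move=> fI fU f_le.
have fIE x y : f (x `&` y)%O = (f x `&` f y)%O.
  by apply/val_inj/setP => -[i j]; rewrite fI in_tamari_meet.
have f_mono x y : (x <= y)%O -> (f x <= f y)%O.
  by move=> /meet_idPl <-; rewrite fIE leIr.
split=> //.
- by move=> x y fxy; apply: le_anti; rewrite !f_le ?fxy.
- move=> x y; apply: le_anti; rewrite leUx !f_mono ?leUl ?leUr // !andbT.
  by apply/tamari_leP; apply: fU.
Qed.

(** * Atoms and the doubled element in [B(m,n)] *)

Section DBoolOrder.
Variables m n : nat.
Implicit Types (x y z : dbool m n) (t : 'I_m + 'I_n).

Definition dbool_atom t : dbool m n := Some [set t].
Definition dbool_p : dbool m n := None.
Definition dbool_elt_a : dbool m n := Some (dbool_a m n).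

Lemma in_dbool_a t : (t \in dbool_a m n) = if t is inl _ then true else false.
Proof.
case: t => t; first by rewrite imset_f.
by apply/imsetP => -[].
Qed.

Lemma dbool_atom_le t x : (dbool_atom t <= x)%O =
  if x is Some X then t \in X else t \in dbool_a m n.
Proof. by case: x => [X|]; rewrite -sub1set. Qed.

(** As far as atoms can tell, a join with [p] is a union with [a], so atoms stay join-prime after
    the doubling. *)
Lemma dbool_atom_leU t x y :
  (dbool_atom t <= x `|` y)%O = (dbool_atom t <= x)%O || (dbool_atom t <= y)%O.
Proof.
rewrite !dbool_atom_le; case: x y => [X|] [Y|] /=; rewrite ?orbb //; first by rewrite inE.
- rewrite /Order.join /=; case: ifP => [/subsetP Xa|_]; last by rewrite inE.
  by have [/Xa->|] := boolP (t \in X).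
- rewrite /Order.join /=; case: ifP => [/subsetP Ya|_]; last by rewrite inE orbC.
  by have [/Ya->|] := boolP (t \in Y); rewrite ?orbT ?orbF.
Qed.

Lemma dbool_elt_a_leE x : (dbool_elt_a <= x)%O = [forall i : 'I_m, (dbool_atom (inl i) <= x)%O].
Proof.
apply/idP/forallP => [ax i|ax].
  apply: le_trans ax; by rewrite dbool_atom_le /= in_dbool_a.
case: x ax => [X|] ax; last exact: subxx.
by apply/subsetP => -[i _|j]; rewrite ?in_dbool_a //; have := ax i; rewrite dbool_atom_le.
Qed.

Lemma dbool_p_leE x : (dbool_p <= x)%O =
  (x == dbool_p) || (dbool_elt_a <= x)%O && [exists j : 'I_n, (dbool_atom (inr j) <= x)%O].
Proof.
case: x => [X|]; last by rewrite lexx eqxx.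
change (dbool_a m n \proper X =
  (dbool_a m n \subset X) && [exists j : 'I_n, (dbool_atom (inr j) <= (Some X : dbool m n))%O]).
rewrite properE; case: (_ \subset X) => //=.
apply/subsetPn/existsP => [[[i|j] tX]|[j]]; rewrite ?in_dbool_a //.
  by move=> _; exists j; rewrite dbool_atom_le.
by rewrite dbool_atom_le => jX; exists (inr j) => //; rewrite in_dbool_a.
Qed.

Lemma dbool_elt_a_le_p : (dbool_elt_a <= dbool_p)%O.
Proof. exact: subxx. Qed.

(** A join of two Boolean elements is Boolean, so it can only be strictly above [p], hence above [a]
    and some [b_j]. *)
Lemma dbool_p_le_join x y : (dbool_p <= x `|` y)%O ->
  [|| (dbool_p <= x)%O, (dbool_p <= y)%O |
    (dbool_elt_a <= x `|` y)%O && [exists j : 'I_n, (dbool_atom (inr j) <= x `|` y)%O]].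
Proof.
rewrite {1}dbool_p_leE => /predU1P[|->]; last by rewrite !orbT.
by case: x y => [X|] [Y|] //= _; rewrite ?lexx ?orbT.
Qed.

(** A Boolean element is the join of the atoms below it, so only [p] needs a separate test. *)
Lemma dbool_leP x y :
  (forall t, (dbool_atom t <= x)%O -> (dbool_atom t <= y)%O) ->
  ((dbool_p <= x)%O -> (dbool_p <= y)%O) -> (x <= y)%O.
Proof.
case: x => [X|] hat hp; last exact: hp.
have {}hat t : t \in X -> (dbool_atom t <= y)%O by move=> tX; apply: hat; rewrite dbool_atom_le.
by case: y hat {hp} => [Y|] hat; apply/subsetP => t /hat; rewrite dbool_atom_le.
Qed.

End DBoolOrder.

Arguments dbool_p {m n}.
Arguments dbool_elt_a {m n}.

(** * The obstruction when [m] and [n] exceed 1 *)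

Lemma dbool_not_embeds (m n l : nat) : 1 < m -> 1 < n ->
  ~ lattice_embeds (dbool m n) (tamari l).
Proof.
move=> m1 n1 [f [f_inj fI fU]].
have f_le (x y : dbool m n) : (f x <= f y)%O = (x <= y)%O.
  by rewrite !leEmeet -fI (inj_eq f_inj).
pose A1 : {set 'I_m + 'I_n} := [set inl (Ordinal (ltnW m1))].
pose A2 := dbool_a m n :\: A1.
pose B1 : {set 'I_m + 'I_n} := [set inr (Ordinal (ltnW n1))].
pose B2 : {set 'I_m + 'I_n} := [set inr (Ordinal n1)].
have A1a : A1 \subset dbool_a m n by rewrite sub1set in_dbool_a.
have A2a : A2 \subset dbool_a m n by apply: subsetDl.
have A12 : A1 :|: A2 = dbool_a m n.
  by rewrite /A2 setDE setUIr setUCr setIT; apply/setUidPr.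
have Ba t B : B \in [:: B1; B2] -> t \in B -> t \notin dbool_a m n.
  by rewrite !inE => /orP[]/eqP->; rewrite inE => /eqP->; rewrite in_dbool_a.
have B12 t : t \in B1 -> t \notin B2 by rewrite !inE => /eqP->.
have [B1_in B2_in] : B1 \in [:: B1; B2] /\ B2 \in [:: B1; B2] by rewrite !inE !eqxx orbT.
pose s X : dbool m n := Some X.
have sU X Y : (s X `|` s Y)%O = s (X :|: Y) by [].
(* A meet of Boolean elements is [p] only if their intersection is [a], which the atom [t] rules
   out. *)
have le_sI (X Y Z : {set 'I_m + 'I_n}) t : t \in dbool_a m n -> t \notin X :&: Y ->
    X :&: Y \subset Z -> (s X `&` s Y <= s Z)%O.
  move=> ta tXY XYZ; suff -> : (s X `&` s Y)%O = s (X :&: Y) by [].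
  rewrite /s /Order.meet /=; case: ifP => // /and3P[_ _ /eqP XY].
  by rewrite XY ta in tXY.
have p_le_s B : B \in [:: B1; B2] -> (dbool_p <= s (dbool_a m n :|: B))%O.
  move=> B_in; change (dbool_a m n \proper dbool_a m n :|: B).
  rewrite properE subsetUl subUset subxx /=.
  by move: B_in; rewrite !inE => /orP[]/eqP->; rewrite sub1set in_dbool_a.
(* Since [f] preserves both operations and reflects the order, the conditions and the conclusion
   become inequalities in [B(m,n)]. *)
have := @tamari_join_distr _ (f (s A1)) (f (s A2)) (f (s B1)) (f (s B2)).
rewrite -!(fU, fI) !f_le !sU A12 => h.
have : (dbool_p <= s (dbool_a m n))%O.
  apply: le_trans (h _ _); first by rewrite lexI !p_le_s.
    apply: (le_sI _ _ _ (inl (Ordinal m1))); rewrite ?in_dbool_a ?inE //.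
    by apply/subsetP => t; rewrite inE => /andP[/B12/negPf->].
  have distr (A : {set 'I_m + 'I_n}) t : A \subset dbool_a m n -> t \in dbool_a m n -> t \notin A ->
      [/\ (s (A :|: B1) `&` s (dbool_a m n) <= s A)%O,
          (s (A :|: B2) `&` s (dbool_a m n) <= s A)%O
        & (s (A :|: B1) `&` s (A :|: B2) <= s A)%O].
    move=> /subsetP Aa ta tA.
    have tB B : B \in [:: B1; B2] -> t \notin B.
      by move=> /Ba hB; apply: contraL ta; apply: hB.
    split; (apply: (le_sI _ _ _ t ta); first
        by rewrite in_setI !in_setU (negPf tA) ?(negPf (tB _ B1_in)) ?(negPf (tB _ B2_in)));
      apply/subsetP => u; rewrite in_setI !in_setU.
    - by case: (u \in A) => //= /andP[/(Ba _ _ B1_in)/negPf->].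
    - by case: (u \in A) => //= /andP[/(Ba _ _ B2_in)/negPf->].
    - by case: (u \in A) => //= /andP[/B12/negPf->].
  move=> e; rewrite !inE => /orP[] /eqP->; rewrite -!(fU, fI) !f_le !sU.
    (* An atom below [a] outside [A1] exists because [m > 1]; for [A2], the atom in [A1] serves. *)
    by apply: (distr _ (inl (Ordinal m1))); rewrite ?in_dbool_a ?inE.
  by apply: (distr _ (inl (Ordinal (ltnW m1)))); rewrite ?in_dbool_a ?inE ?eqxx.
by apply/negP; change (~~ (dbool_a m n \proper dbool_a m n)); rewrite properxx.
Qed.

(** * The embedding for [m <= 1] *)

Section EmbedFewA.
Variables m n : nat.
Implicit Types x y z : dbool m n.

(* The position [n.+1] keeps the images of [a] and of the bottom distinct when
   [n = 0]. *)
Definition few_a_cond z (i k : nat) : bool :=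
  if i == 0 then (if k == n.+2 then dbool_p <= z else dbool_elt_a <= z)%O
  else [exists j : 'I_n, (j.+1 == i) && (dbool_atom (inr j) <= z)%O].

(** Transitivity at the right end [n + 2] holds because [a] and some [b_j] below [z] force [p <= z];
    the prefix condition rests on [a <= p]. *)
Lemma few_a_is_tamari z :
  is_tamari [set ij : 'I_n.+3 * 'I_n.+3 | (ij.1 < ij.2) && few_a_cond z ij.1 ij.2].
Proof.
apply/is_tamariP; split=> [i j|i j k|i j k /andP[ij jk]]; rewrite !inE /= /few_a_cond.
- by case/andP.
- case/andP=> ij zij /andP[jk zjk]; rewrite (ltn_trans ij jk) /=.
  case: (val i =P 0) zij => // _.
  have -> : (j == n.+2 :> nat) = false by have := ltn_ord k; lia.
  move=> zsa; case: ifP => // _; rewrite dbool_p_leE zsa; apply/orP; right.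
  have j0 : (j == 0 :> nat) = false by lia.
  rewrite j0 in zjk.
  by case/existsP: zjk => t /andP[_ zt]; apply/existsP; exists t.
- case/andP=> _; rewrite ij /=; case: ifP => // _.
  have -> : (j == n.+2 :> nat) = false by have := ltn_ord k; lia.
  by case: ifP => // _; apply: le_trans; apply: dbool_elt_a_le_p.
Qed.

Definition few_a_map z : tamari n.+3 := Tamari (few_a_is_tamari z).

Hypothesis m_le1 : m <= 1.

Lemma dbool_elt_a_atom_le x (i : 'I_m) : (dbool_elt_a <= x)%O = (dbool_atom (inl i) <= x)%O.
Proof.
rewrite dbool_elt_a_leE; apply/forallP/idP => [/(_ i) //|ix j].
by have -> : j = i by apply: val_inj => /=; have := conj (ltn_ord i) (ltn_ord j); lia.
Qed.

(** As [m <= 1], [a] is either the bottom, below everything, or an atom, hence join-prime. *)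
Lemma dbool_elt_a_leU x y : (dbool_elt_a <= x `|` y)%O = (dbool_elt_a <= x)%O || (dbool_elt_a <= y)%O.
Proof.
case: (posnP m) => [m0|m_gt0].
  have sa0 z : (dbool_elt_a <= z)%O.
    by rewrite dbool_elt_a_leE; apply/forallP => i; have := ltn_ord i; lia.
  by rewrite !sa0.
by rewrite !(dbool_elt_a_atom_le _ (Ordinal m_gt0)) dbool_atom_leU.
Qed.

Lemma in_few_a_map z (i k : 'I_n.+3) :
  ((i, k) \in tamari_val (few_a_map z)) = (i < k) && few_a_cond z i k.
Proof. by rewrite inE. Qed.

Lemma few_a_embedding : lattice_embedding few_a_map.
Proof.
have inr_lt (j : 'I_n) : j.+1 < n.+3 by have := ltn_ord j; lia.
have in_inr z (j : 'I_n) :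
    ((Ordinal (inr_lt j), ord_max) \in tamari_val (few_a_map z)) =
    (dbool_atom (inr j) <= z)%O.
  have jn : j.+1 < n.+2 by rewrite ltnS ltnW ?ltnS.
  rewrite in_few_a_map /= jn /few_a_cond /=.
  apply/existsP/idP => [[i /andP[/eqP[/val_inj->]]] //|zj].
  by exists j; rewrite eqxx.
apply: tamari_embedding_of_meet.
- move=> x y i k; rewrite !in_few_a_map /few_a_cond; case: (i < k) => //=.
  case: ifP => _; first by case: ifP => _; rewrite lexI.
  apply/existsP/andP => [[j]|[]].
    by rewrite lexI => /and3P[ji xj yj]; split; apply/existsP; exists j; rewrite ji.
  move=> /existsP[j /andP[/eqP ji xj]] /existsP[j' /andP[/eqP j'i yj]].
  have jj' : j' = j by apply: val_inj => /=; lia.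
  by exists j; rewrite ji eqxx lexI xj -jj'.
- move=> x y i k; rewrite in_few_a_map => /andP[ik].
  rewrite /few_a_cond; case: ifP => i0; last first.
    case/existsP => j /andP[ji]; rewrite dbool_atom_leU => xy.
    apply: tamari_join_mem; rewrite /tamari_union !in_few_a_map ik /few_a_cond i0.
    by apply/orP; case/orP: xy => xyj; [left|right]; apply/existsP; exists j; rewrite ji.
  have in_sa (k' : 'I_n.+3) : 0 < k' < n.+2 -> (dbool_elt_a <= x `|` y)%O ->
      (i, k') \in tamari_val (few_a_map x `|` few_a_map y)%O.
    move=> /andP[k'0 k'n]; rewrite dbool_elt_a_leU => xy.
    apply: tamari_join_mem; rewrite /tamari_union !in_few_a_map /few_a_cond i0.
    by rewrite (eqP i0) k'0 (ltn_eqF k'n).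
  case: ifP => [/eqP kn|kn]; last by apply: in_sa; have := ltn_ord k; lia.
  case/dbool_p_le_join/or3P => [xp|yp|/andP[xya /existsP[j]]].
  + apply: tamari_join_mem; rewrite /tamari_union !in_few_a_map ik /few_a_cond i0.
    by rewrite kn eqxx xp.
  + apply: tamari_join_mem; rewrite /tamari_union !in_few_a_map ik /few_a_cond i0.
    by rewrite kn eqxx yp orbT.
  + rewrite dbool_atom_leU -!in_inr => xyj.
    have -> : k = ord_max by apply: val_inj.
    (* The join reaches [(0, n + 2)] through [j + 1], by a pair due to [a] and then one due to
       [b_j]. *)
    apply: (tamari_trans (j := Ordinal (inr_lt j))); last exact: tamari_join_mem.
    by apply: in_sa => //=; have := ltn_ord j; lia.
- move=> x y /tamari_leP fxy; apply: dbool_leP => [[i|j]|px].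
  + rewrite -!dbool_elt_a_atom_le => ax.
    have := fxy ord0 (lift ord0 ord0); rewrite !in_few_a_map /few_a_cond /=.
    by apply.
  + by rewrite -!in_inr; apply: fxy.
  + have := fxy ord0 ord_max; rewrite !in_few_a_map /few_a_cond /= eqxx.
    by apply.
Qed.

End EmbedFewA.

(** * The embedding for [n <= 1] and [m > 0] *)

Section EmbedFewB.
Variables m n : nat.
Hypothesis n_le1 : n <= 1.
Implicit Types x y z : dbool m n.

Definition dbool_rank (t : 'I_m + 'I_n) : nat := if t is inl i then i else m.

Lemma dbool_rank_inj : injective dbool_rank.
Proof.
move=> [i|i] [j|j] /= ij.
- by congr inl; apply: val_inj.
- by have := ltn_ord i; lia.
- by have := ltn_ord j; lia.
- by congr inr; apply: val_inj => /=; have := conj (ltn_ord i) (ltn_ord j); lia.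
Qed.

Lemma dbool_rank_lt t : dbool_rank t < m.+1.
Proof. by case: t => [i|j] //=; apply: ltnW; rewrite ltnS. Qed.

(* If [n = 0], then [few_b_step z m] is always false. *)
Definition few_b_step z (s : nat) : bool :=
  [exists t, (dbool_rank t == s) && (dbool_atom t <= z)%O].

Lemma few_b_step_rank z t : few_b_step z (dbool_rank t) = (dbool_atom t <= z)%O.
Proof.
apply/existsP/idP => [[u /andP[/eqP/dbool_rank_inj->]] //|zt].
by exists t; rewrite eqxx.
Qed.

Lemma few_b_stepI x y s : few_b_step (x `&` y)%O s = few_b_step x s && few_b_step y s.
Proof.
apply/existsP/andP => [[t /andP[/eqP<-]]|[/existsP[t /andP[/eqP<- xt]]]].
  by rewrite lexI !few_b_step_rank => /andP.
by rewrite few_b_step_rank => yt; exists t; rewrite eqxx lexI xt.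
Qed.

Lemma few_b_stepU x y s : few_b_step (x `|` y)%O s = few_b_step x s || few_b_step y s.
Proof.
apply/existsP/orP => [[t /andP[/eqP<-]]|].
  by rewrite dbool_atom_leU !few_b_step_rank => /orP.
by case=> /existsP[t /andP[ts zt]]; exists t; rewrite ts dbool_atom_leU zt ?orbT.
Qed.

(** Step [m] can only come from an atom [b], so both sides fail when [n = 0]; for [n = 1] they say
    that [z] is the top. *)
Lemma few_b_step_all z : (forall s, s < m.+1 -> few_b_step z s) <->
  (dbool_elt_a <= z)%O && [exists j : 'I_n, (dbool_atom (inr j) <= z)%O].
Proof.
split=> [stepz|/andP[az /existsP[j zj]] s].
  apply/andP; split.
    rewrite dbool_elt_a_leE; apply/forallP => i.
    by rewrite -few_b_step_rank stepz ?dbool_rank_lt.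
  have /existsP[[i|j] /andP[/eqP /= im zt]] := stepz m (ltnSn m).
    by have := ltn_ord i; lia.
  by apply/existsP; exists j.
rewrite ltnS leq_eqVlt => /orP[/eqP->|sm].
  by rewrite -[m]/(dbool_rank (inr j)) few_b_step_rank.
rewrite -[s]/(dbool_rank (inl (Ordinal sm))) few_b_step_rank.
by move: az; rewrite dbool_elt_a_leE => /forallP.
Qed.

(** For [m > 0], the exception gives [p] the pair [(0, m + 1)] without the unit step [(m, m + 1)],
    which separates its image from that of [a]. *)
Definition few_b_cond z (i k : nat) : bool :=
  if (i == 0) && (k == m.+1) then (dbool_p <= z)%O
  else [forall s : 'I_m.+1, (i <= s < k) ==> few_b_step z s].

(** Two pairs composing to [(0, m + 1)] contain every step, which forces [p <= z]. A proper prefix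
    of [(0, m + 1)] needs only steps below [m], and [a <= p] provides these. *)
Lemma few_b_is_tamari z :
  is_tamari [set ij : 'I_m.+2 * 'I_m.+2 | (ij.1 < ij.2) && few_b_cond z ij.1 ij.2].
Proof.
apply/is_tamariP; split=> [i j|i j k|i j k /andP[ij jk]]; rewrite !inE /= /few_b_cond.
- by case/andP.
- case/andP=> ij + /andP[jk]; rewrite (ltn_trans ij jk) /=.
  have -> : (j == m.+1 :> nat) = false by have := ltn_ord k; lia.
  have -> : (j == 0 :> nat) = false by lia.
  rewrite andbF /= => /forallP zij /forallP zjk.
  have zik (s : 'I_m.+1) : i <= s < k -> few_b_step z s.
    move=> /andP[si sk]; have [sj|js] := ltnP s j.
      by apply: (implyP (zij s)); rewrite si.
    by apply: (implyP (zjk s)); rewrite js.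
  case: ifP => [/andP[/eqP i0 /eqP km]|_]; last by apply/forallP => s; apply/implyP/zik.
  rewrite dbool_p_leE; apply/orP; right; apply/few_b_step_all => s sm.
  by apply: (zik (Ordinal sm)); rewrite i0 km.
- case/andP=> _; rewrite ij /=.
  have -> : (j == m.+1 :> nat) = false by have := ltn_ord k; lia.
  rewrite andbF; case: ifP => [/andP[/eqP i0 /eqP km] pz|_ /forallP zik].
    apply/forallP => s; apply/implyP => /andP[_ sj].
    have sm : s < m by lia.
    rewrite -[val s]/(dbool_rank (inl (Ordinal sm))) few_b_step_rank.
    by have := le_trans (dbool_elt_a_le_p m n) pz; rewrite dbool_elt_a_leE => /forallP.
  apply/forallP => s; apply/implyP => /andP[si sj]; apply: (implyP (zik s)).
  by rewrite si (ltn_trans sj jk).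
Qed.

Definition few_b_map z : tamari m.+2 := Tamari (few_b_is_tamari z).

Hypothesis m_gt0 : 0 < m.

Lemma in_few_b_map z (i k : 'I_m.+2) :
  ((i, k) \in tamari_val (few_b_map z)) = (i < k) && few_b_cond z i k.
Proof. by rewrite inE. Qed.

Lemma in_few_b_map_step z (i k : 'I_m.+2) : k = i.+1 :> nat ->
  ((i, k) \in tamari_val (few_b_map z)) = few_b_step z i.
Proof.
move=> ki; rewrite in_few_b_map ki ltnSn /few_b_cond /=.
(* Since [m > 0], the exceptional pair [(0, m + 1)] is no unit step. *)
have -> : (i == 0 :> nat) && (i.+1 == m.+1) = false by lia.
have im : i < m.+1 by have := ltn_ord k; lia.
apply/forallP/idP => [/(_ (Ordinal im)) /=|zi s]; first by rewrite leqnn ltnSn.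
by apply/implyP => si; have -> : s = i :> nat by lia.
Qed.

Lemma few_b_embedding : lattice_embedding few_b_map.
Proof.
apply: tamari_embedding_of_meet.
- move=> x y i k; rewrite !in_few_b_map /few_b_cond; case: (i < k) => //=.
  case: ifP => _; first by rewrite lexI.
  apply/forallP/andP => [xy|[/forallP xs /forallP ys] s].
    by split; apply/forallP => s; apply/implyP => /(implyP (xy s));
       rewrite few_b_stepI => /andP[].
  by apply/implyP => sik; rewrite few_b_stepI (implyP (xs s)) ?(implyP (ys s)).
- move=> x y i k; rewrite in_few_b_map => /andP[ik].
  have in_steps : (forall s : 'I_m.+1, i <= s < k -> few_b_step (x `|` y)%O s) ->
      (i, k) \in tamari_val (few_b_map x `|` few_b_map y)%O.
    move=> stepxy; apply: tamari_steps => // s t si ts tk.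
    have sm : s < m.+1 by have := ltn_ord t; lia.
    apply: tamari_join_mem; rewrite /tamari_union !in_few_b_map_step // -few_b_stepU.
    by apply: (stepxy (Ordinal sm)); rewrite si -ts.
  rewrite /few_b_cond; case: ifP => [ik0m|_ /forallP xy]; last first.
    by apply: in_steps => s; apply/implyP.
  case/dbool_p_le_join/or3P => [xp|yp|/few_b_step_all xy].
  + by apply: tamari_join_mem; rewrite /tamari_union !in_few_b_map ik /few_b_cond ik0m xp.
  + by apply: tamari_join_mem; rewrite /tamari_union !in_few_b_map ik /few_b_cond ik0m yp orbT.
  (* All unit steps inside [(0, m + 1)] are in the join, and transitivity composes them. *)
  + by apply: in_steps => s _; apply: xy.
- move=> x y /tamari_leP fxy; apply: dbool_leP => [t|px].
    have t_lt : dbool_rank t < m.+2 by apply: ltnW; rewrite ltnS dbool_rank_lt.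
    have t1_lt : (dbool_rank t).+1 < m.+2 by rewrite ltnS dbool_rank_lt.
    have := fxy (Ordinal t_lt) (Ordinal t1_lt).
    by rewrite !in_few_b_map_step //= !few_b_step_rank.
  have := fxy ord0 ord_max; rewrite !in_few_b_map /few_b_cond /= eqxx.
  by apply.
Qed.

End EmbedFewB.

Theorem theorem10p7 (m n : nat) :
  (exists l : nat, 0 < l /\ lattice_embeds (dbool m n) (tamari l))
  <-> (m <= 1 \/ n <= 1).
Proof.
split=> [[l [_ emb]]|mn].
  have [m1|m1] := leqP m 1; first by left.
  by have [n1|n1] := leqP n 1; [right | case: (dbool_not_embeds m1 n1 emb)].
(* Deciding [m <= 1] first leaves [m > 1] in the other case, hence the [0 < m] that the second
   embedding needs. *)
have [m1|m1] := leqP m 1.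
  by exists n.+3; split=> //; exists (@few_a_map m n); apply: few_a_embedding.
have n1 : n <= 1 by case: mn => //; rewrite leqNgt m1.
exists m.+2; split=> //; exists (few_b_map n1).
by apply: few_b_embedding; apply: ltnW.
Qed.
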